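(* Let $(X,\lambda)$ be a convergence approach space and $A\subset X$. Then $$\mathscr{C}(\operatorname{adh}A)=\mathscr{C}(\theta_A).$$ Moreover, the following are equivalent: (1) $\theta_A\in\mathscr{C}(X,V)$; (2) $\theta_A^{\epsilon}\in\mathscr{C}(X,V)$ for every $\epsilon\in V\setminus\{0\}$; (3) $A$ is $r(\lambda)$-closed.
   Context: Throughout, $V=[0,1]$ with its usual order and $\otimes$ is multiplication (equivalently, via $-\ln$, $V=[0,\infty]^{op}$ with $\otimes=+$). Division is $t\oslash x=\min(t/x,1)$ if $x\neq 0$ and $t\oslash 0=1$. Filters are proper; $\mathbb{F}X$ (resp. $\mathbb{U}X$) is the set of filters (resp. ultrafilters) on $X$, and $\{x\}^{\uparrow}$ is the principal ultrafilter of $x$. $V^X$ carries the pointwise order. A convergence approach space $(X,\lambda)$ is a set $X$ with a map $\lambda:\mathbb{F}X\to V^X$ such that $\mathcal F\subset\mathcal G$ implies $\lambda(\mathcal F)\le\lambda(\mathcal G)$, and $\lambda(\{x\}^{\uparrow})(x)=1$ for all $x$. A morphism $f:(X,\lambda_X)\to(Y,\lambda_Y)$ is a map with $\lambda_X(\mathcal F)(x)\le\lambda_Y(f[\mathcal F])(f(x))$ for all $\mathcal F\in\mathbb{F}X$, $x\in X$, where $f[\mathcal F]$ is the image filter. $V$ carries the convergence approach structure $\lambda_V(\mathcal F)(v)=v\oslash\bigwedge_{F\in\mathcal F}\bigvee F$, and $\mathscr{C}(X,V)$ is the set of morphisms $(X,\lambda)\to(V,\lambda_V)$. For $A\subset X$,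 $\operatorname{adh}A(x)=\bigvee\{\lambda(\mathcal U)(x):\mathcal U\in\mathbb{U}X,\ A\in\mathcal U\}$ (with $\bigvee\emptyset=0$). $\theta_A:X\to V$ is the indicator function of $A$ ($1$ on $A$, $0$ off $A$), and $\theta_A^\epsilon:X\to V$ is $1$ on $A$ and $\epsilon$ off $A$. The set $\mathscr{C}(X,V)$ is closed under arbitrary pointwise infima; for $f\in V^X$, $\mathscr{C}(f)=\bigwedge\{g\in\mathscr{C}(X,V): f\le g\}$ (pointwise infimum) is the smallest element of $\mathscr{C}(X,V)$ above $f$. $r(\lambda)$ is the convergence on $X$ given by $x\in\lim_{r(\lambda)}\mathcal F\iff\lambda(\mathcal F)(x)>0$. $A\subset X$ is closed for a convergence $\xi$ if $A\in\mathcal F$ implies $\lim_\xi\mathcal F\subset A$, for every $\mathcal F\in\mathbb{F}X$. *)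

(* Defs.v *)
From mathcomp Require Import all_boot all_order all_algebra.
From mathcomp Require Import interval_inference.
From mathcomp Require Import boolp classical_sets filter reals.

Set Implicit Arguments.
Unset Strict Implicit.
Unset Printing Implicit Defensive.

Import Order.TTheory GRing.Theory Num.Theory.

Local Open Scope classical_set_scope.
Local Open Scope ring_scope.

(* The quantale V = [0,1] is the library's type {i01 R}, over an arbitrary
   model R of the real numbers. *)
Section UnitInterval.
Context {R : realType}.
Implicit Types (S : set {i01 R}) (t x v : {i01 R}).

(* The extra point 0 (resp. 1) changes nothing when S is nonempty and gives the
   conventions isup(set0) = 0 and iinf(set0) = 1 of the complete lattice [0,1];
   see isup_ub, isup_le, iinf_lb and le_iinf below. *)
Definition rsup S : R := sup (0 |` [set s%:num | s in S]).
Definition rinf S : R := inf (1 |` [set s%:num | s in S]).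

Lemma ubound1 S : ubound (0 |` [set s%:num | s in S]) (1 : R).
Proof. by move=> _ [->|[s _ <-]]; [exact: ler01 | exact: le1]. Qed.

Lemma lbound0 S : lbound (1 |` [set s%:num | s in S]) (0 : R).
Proof. by move=> _ [->|[s _ <-]]; [exact: ler01 | exact: ge0]. Qed.

Lemma rsup_ge0 S : 0 <= rsup S.
Proof. by apply: ub_le_sup; [exists 1; exact: ubound1 | left]. Qed.

Lemma rsup_le1 S : rsup S <= 1.
Proof. by apply: ge_sup; [exists 0; left | exact: ubound1]. Qed.

Lemma rinf_ge0 S : 0 <= rinf S.
Proof. by apply: lb_le_inf; [exists 1; left | exact: lbound0]. Qed.

Lemma rinf_le1 S : rinf S <= 1.
Proof. by apply: ge_inf; [exists 0; exact: lbound0 | left]. Qed.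

Definition isup S : {i01 R} := Itv01 (rsup_ge0 S) (rsup_le1 S).
Definition iinf S : {i01 R} := Itv01 (rinf_ge0 S) (rinf_le1 S).

Lemma isup_ub S s : S s -> s <= isup S.
Proof.
move=> Ss; rewrite -num_le; apply: ub_le_sup; first by exists 1; exact: ubound1.
by right; exists s.
Qed.

Lemma isup_le S v : (forall s, S s -> s <= v) -> isup S <= v.
Proof.
move=> Sv; rewrite -num_le; apply: ge_sup; first by exists 0; left.
by move=> _ [->|[s Ss <-]]; [exact: ge0 | rewrite num_le; exact: Sv].
Qed.

Lemma iinf_lb S s : S s -> iinf S <= s.
Proof.
move=> Ss; rewrite -num_le; apply: ge_inf; first by exists 0; exact: lbound0.
by right; exists s.
Qed.

Lemma le_iinf S v : (forall s, S s -> v <= s) -> v <= iinf S.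
Proof.
move=> Sv; rewrite -num_le; apply: lb_le_inf; first by exists 1; left.
by move=> _ [->|[s Ss <-]]; [exact: le1 | rewrite num_le; exact: Sv].
Qed.

Definition rdiv t x : R :=
  if x%:num == 0 then 1 else Num.min (t%:num / x%:num) 1.

Lemma rdiv_ge0 t x : 0 <= rdiv t x.
Proof. by rewrite /rdiv; case: ifP => // _; rewrite le_min ler01 divr_ge0. Qed.

Lemma rdiv_le1 t x : rdiv t x <= 1.
Proof. by rewrite /rdiv; case: ifP => // _; rewrite ge_min lexx orbT. Qed.

Definition idiv t x : {i01 R} := Itv01 (rdiv_ge0 t x) (rdiv_le1 t x).

Lemma idiv_nonincr t x v : x <= v -> idiv t v <= idiv t x.
Proof.
move=> xv; rewrite -num_le /= /rdiv.
have [//|x0] := eqVneq x%:num 0; first by have := rdiv_le1 t v; rewrite /rdiv.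
have xgt0 : 0 < x%:num by rewrite lt_neqAle eq_sym x0 ge0.
have vgt0 : 0 < v%:num by apply: lt_le_trans xgt0 _.
rewrite (gt_eqF vgt0) le_min !ge_min lexx orbT andbT.
by rewrite ler_wpM2l ?lef_pV2.
Qed.

Lemma idivvv v : idiv v v = 1%:i01.
Proof.
apply/val_inj; rewrite /= /rdiv; case: ifPn => // v0.
by rewrite divff // minxx.
Qed.

End UnitInterval.

Notation "t ⊘ x" := (idiv t x) (at level 40, left associativity) : ring_scope.

(* lambda is a total function on set systems; only its values on proper filters
   are constrained, and only those values are used below. *)
Record convergence_approach (R : realType) (X : Type) := ConvergenceApproach {
  lambda :> set_system X -> X -> {i01 R} ;
  lambda_mono : forall F G : set_system X, ProperFilter F -> ProperFilter G ->
    F `<=` G -> forall x, lambda F x <= lambda G x ;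
  lambda_principal : forall x, lambda (principal_filter x) x = 1%:i01
}.

Definition ca_morphism (R : realType) (X Y : Type)
    (lX : convergence_approach R X) (lY : convergence_approach R Y)
    (f : X -> Y) : Prop :=
  forall F : set_system X, ProperFilter F ->
    forall x, lX F x <= lY (fmap f F) (f x).

Section LambdaV.
Context {R : realType}.

Definition lambdaV_fun (F : set_system {i01 R}) (v : {i01 R}) : {i01 R} :=
  v ⊘ iinf [set isup B | B in F].

Lemma lambdaV_mono (F G : set_system {i01 R}) :
  ProperFilter F -> ProperFilter G ->
  F `<=` G -> forall v, lambdaV_fun F v <= lambdaV_fun G v.
Proof.
move=> _ _ FG v; apply: idiv_nonincr; apply: le_iinf => _ [B FB <-].
by apply: iinf_lb; exists B => //; exact: FG.
Qed.

Lemma lambdaV_principal (v : {i01 R}) :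
  lambdaV_fun (principal_filter v) v = 1%:i01.
Proof.
rewrite /lambdaV_fun (_ : iinf _ = v) ?idivvv//; apply/le_anti/andP; split.
  apply: (@le_trans _ _ (isup [set v])); last by apply: isup_le => _ ->.
  by apply: iinf_lb; exists [set v].
apply: le_iinf => _ [B /principal_filterP Bv <-]; exact: isup_ub.
Qed.

Definition lambdaV : convergence_approach R {i01 R} :=
  ConvergenceApproach lambdaV_mono lambdaV_principal.

End LambdaV.

Section Objects.
Context {R : realType} {X : Type} (l : convergence_approach R X).
Implicit Types (A : set X) (f g : X -> {i01 R}) (e : {i01 R}).

Definition CXV : set (X -> {i01 R}) := [set f | ca_morphism l lambdaV f].

Definition adh A : X -> {i01 R} := fun x =>
  isup [set l U x | U in [set U : set_system X | UltraFilter U /\ U A]].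

(* CXV is closed under pointwise infima, so this is its smallest element above f. *)
Definition Chull f : X -> {i01 R} := fun x =>
  iinf [set g x | g in [set g | CXV g /\ forall y, f y <= g y]].

Definition theta_eps A e : X -> {i01 R} :=
  fun x => if x \in A then 1%:i01 else e.

Definition theta A : X -> {i01 R} :=
  fun x => if x \in A then 1%:i01 else 0%:i01.

(* r(lambda): the limit set of F is the set of x with lambda F x > 0. *)
Definition rconv (F : set_system X) : set X := [set x | 0%:i01 < l F x].

End Objects.

(* A convergence is given by its limit operator xi, used on proper filters. *)
Definition conv_closed (X : Type) (xi : set_system X -> set X) (A : set X) :
    Prop :=
  forall F : set_system X, ProperFilter F -> F A -> xi F `<=` A.

(* Main.v *)
(** Write [c] for the limsup of [g] along [F]: [g] is a morphism iff
    [lambda F x <= g x ⊘ c] for all [F] and [x]. When [A] belongs to [F] and [g]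
    is [1] on [A], [c = 1], so [lambda F x <= g x]. Hence the morphisms above
    [theta A] are those above [adh A], and (1) or (2) makes [A] closed, taking
    [e < lambda F x] in case (2). Conversely, let [A] be closed and [x] be outside
    [A]. Either the complement of [A] is in [F], and then [c <= e], or [F] has a
    proper refinement containing [A], which forces [lambda F x = 0]. *)
Require Import Defs.
From mathcomp Require Import all_boot all_order all_algebra.
From mathcomp Require Import interval_inference.
From mathcomp Require Import boolp classical_sets filter reals.
Set Implicit Arguments.
Unset Strict Implicit.
Unset Printing Implicit Defensive.

Import Order.TTheory GRing.Theory Num.Theory.
Local Open Scope classical_set_scope.
Local Open Scope ring_scope.

Lemma i01_ge0 (R : realType) (v : {i01 R}) : 0%:i01 <= v.
Proof. by rewrite -num_le; exact: ge0. Qed.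

Lemma i01_le1 (R : realType) (v : {i01 R}) : v <= 1%:i01.
Proof. by rewrite -num_le; exact: le1. Qed.

Lemma i01_ge1 (R : realType) (v : {i01 R}) : 1%:i01 <= v -> v = 1%:i01.
Proof. by move=> v1; apply/le_anti; rewrite i01_le1. Qed.

Lemma idiv1 (R : realType) (t : {i01 R}) : t ⊘ 1%:i01 = t.
Proof.
apply/val_inj; rewrite /= /rdiv /= oner_eq0 divr1.
by apply/min_idPl; exact: le1.
Qed.

Lemma idiv_eq1 (R : realType) (t x : {i01 R}) : x <= t -> t ⊘ x = 1%:i01.
Proof.
move=> xt; by apply: i01_ge1; rewrite -(idivvv t); exact: idiv_nonincr.
Qed.

Section Morphisms.
Context (R : realType) (X : Type) (l : convergence_approach R X).
Implicit Types (A : set X) (g : X -> {i01 R}) (F : set_system X) (e : {i01 R}).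

(** Each set of the image filter contains the value 1, because its preimage meets [A]; the limsup is
    thus 1, and division by 1 changes nothing. *)
Lemma CXV_ge_lambda A g F x : CXV l g -> ProperFilter F -> F A ->
  (forall y, A y -> g y = 1%:i01) -> l F x <= g x.
Proof.
move=> Cg PF FA gA; rewrite -[leRHS]idiv1.
apply: (le_trans (Cg F PF x)); apply: idiv_nonincr.
apply: le_iinf => _ [B FB <-].
have /filter_ex[y [By Ay]] : F (g @^-1` B `&` A) by exact: filterI.
by rewrite -(gA y Ay); exact: isup_ub.
Qed.

Lemma theta_eps_in A e y : A y -> theta_eps A e y = 1%:i01.
Proof. by move=> Ay; rewrite /theta_eps mem_set. Qed.

Lemma theta_eps_notin A e y : ~ A y -> theta_eps A e y = e.
Proof. by move=> Ay; rewrite /theta_eps memNset. Qed.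

Lemma theta_le A g :
  (forall y, theta A y <= g y) <-> (forall y, A y -> g y = 1%:i01).
Proof.
split=> [Ag y Ay|gA y].
  apply: i01_ge1.
  (* [theta A] is convertible to [theta_eps A 0%:i01], so the results on [theta_eps] cover it as the
     case [e = 0]. *)
  by have := Ag y; rewrite -[theta A]/(theta_eps A 0%:i01) theta_eps_in.
have [Ay|nAy] := pselect (A y); first by rewrite gA//; exact: i01_le1.
by rewrite -[theta A]/(theta_eps A 0%:i01) theta_eps_notin//; exact: i01_ge0.
Qed.

Lemma adh_in A y : A y -> adh l A y = 1%:i01.
Proof.
move=> Ay; apply: i01_ge1.
rewrite -(lambda_principal l y); apply: isup_ub.
exists (principal_filter y) => //; split; last exact/principal_filterP.
exact: principal_filter_ultra.
Qed.

(** The two hulls are infima over the same set of morphisms. *)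
Lemma CXV_adh_le A g : CXV l g ->
  (forall y, adh l A y <= g y) <-> (forall y, theta A y <= g y).
Proof.
move=> Cg; split=> [adhg|/theta_le gA y].
  apply/theta_le => y Ay; apply: i01_ge1.
  by rewrite -(adh_in Ay).
apply: isup_le => _ [U [UU UA] <-]; exact: CXV_ge_lambda UA gA.
Qed.

Lemma Chull_adh A : Chull l (adh l A) = Chull l (theta A).
Proof.
apply/funext => x; congr (iinf (image _ _)).
by apply/seteqP; split=> g [Cg /(CXV_adh_le A Cg)].
Qed.

(** Allowing [e = 0] lets this give both (1) and (2) from (3). *)
Lemma closed_CXV_theta_eps A e :
  conv_closed (rconv l) A -> CXV l (theta_eps A e).
Proof.
move=> clA F PF x.
have [Ax|nAx] := pselect (A x).
  by rewrite theta_eps_in// /= /lambdaV_fun idiv_eq1; exact: i01_le1.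
rewrite theta_eps_notin//.
have [FnA|FnA] := pselect (F (~` A)).
  rewrite /= /lambdaV_fun idiv_eq1; first exact: i01_le1.
  (* The image filter contains the singleton of [e], since [theta_eps A e] is constant off [A]; this
     bounds the limsup by [e]. *)
  apply: (@le_trans _ _ (isup [set e])); last by apply: isup_le => _ ->.
  apply: iinf_lb; exists [set e] => //.
  apply: (@filterS _ F) FnA => y nAy.
  exact: theta_eps_notin.
(* The refinement of [F] by [A] omits the empty set exactly because the complement of [A] is not in
   [F]. *)
have PG : ProperFilter (within A F) by exact: Build_ProperFilter FnA _.
have : ~ rconv l (within A F) x.
  by move=> limx; apply: nAx; apply: (clA (within A F)) limx; exact: withinT.
move=> /negP; rewrite -leNgt => l0.
apply: (@le_trans _ _ 0%:i01); last exact: i01_ge0.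
apply: le_trans l0; apply: lambda_mono => // P FP.
exact: filterS FP.
Qed.

Lemma CXV_theta_eps_le A e F x : CXV l (theta_eps A e) ->
  ProperFilter F -> F A -> ~ A x -> l F x <= e.
Proof.
move=> Ce PF FA nAx; rewrite -(theta_eps_notin e nAx).
apply: CXV_ge_lambda FA _ => // y; exact: theta_eps_in.
Qed.

Lemma CXV_theta_closed A : CXV l (theta A) -> conv_closed (rconv l) A.
Proof.
move=> CA F PF FA x lFx; apply: contrapT => nAx.
have := CXV_theta_eps_le CA PF FA nAx.
by rewrite leNgt lFx.
Qed.

Lemma CXV_theta_eps_closed A :
  (forall e, e <> 0%:i01 -> CXV l (theta_eps A e)) ->
  conv_closed (rconv l) A.
Proof.
move=> Ceps F PF FA x lFx; apply: contrapT => nAx.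
have lF0 : 0 < (l F x)%:num by [].
(* Half of [l F x] serves as [e]: it is nonzero, yet too small to bound [l F x]. *)
have h0 : 0 < (l F x)%:num / 2 by rewrite divr_gt0.
have hl : (l F x)%:num / 2 < (l F x)%:num.
  by rewrite ltr_pdivrMr// ltr_pMr// ltr1n.
have h1 : (l F x)%:num / 2 <= 1 by apply: (le_trans (ltW hl)); exact: le1.
pose e := Itv01 (ltW h0) h1.
have e0 : e <> 0%:i01.
  by move=> /(congr1 (fun v : {i01 R} => v%:num)) /= e0; move: (h0); rewrite e0 ltxx.
have := CXV_theta_eps_le (Ceps e e0) PF FA nAx.
by rewrite leNgt -num_lt /= hl.
Qed.

End Morphisms.

Theorem theorem14 (R : realType) (X : Type) (l : convergence_approach R X)
    (A : set X) :
  Chull l (adh l A) = Chull l (theta A) /\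
  (CXV l (theta A) <->
     (forall e : {i01 R}, e <> 0%:i01 -> CXV l (theta_eps A e))) /\
  ((forall e : {i01 R}, e <> 0%:i01 -> CXV l (theta_eps A e)) <->
     conv_closed (rconv l) A).
Proof.
split; first exact: Chull_adh.
split; split.
- by move=> /CXV_theta_closed clA e _; exact: closed_CXV_theta_eps.
- by move=> /CXV_theta_eps_closed; exact: closed_CXV_theta_eps.
- exact: CXV_theta_eps_closed.
- by move=> clA e _; exact: closed_CXV_theta_eps.
Qed.
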